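(* Let $n\ge2$ and $k\ge1$ be given integers. Then there exist constants $C_{n,k}$ and $D_{n,k}$ such that, as $d\to\infty$ (over positive integers), $$\mathbb{E}[X_{n,dn+1}^k]=C_{n,k}\,d^{2k}+O(d^{2k-1}),\qquad \mathbb{E}[X_{n,dn-1}^k]=D_{n,k}\,d^{2k}+O(d^{2k-1}).$$
   Context: A partition $\lambda=(\lambda_1\ge\dots\ge\lambda_\ell)$ has size $|\lambda|=\sum_i\lambda_i$. The hook length of a box of its Young diagram is the number of boxes directly to its right, directly below it, plus the box itself. For a positive integer $t$, $\lambda$ is a $t$-core if none of its hook lengths is divisible by $t$; an $(s,t)$-core is both an $s$-core and a $t$-core. For coprime $s,t$, $X_{s,t}$ denotes the size of a partition chosen uniformly at random from the finite set of $(s,t)$-core partitions with distinct parts. *)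

(* Defs.v *)
From mathcomp Require Import all_boot all_order all_algebra.
From mathcomp Require Import finmap.
From mathcomp Require Import all_classical all_reals all_analysis.

Set Implicit Arguments.
Unset Strict Implicit.
Unset Printing Implicit Defensive.

Import Order.TTheory GRing.Theory Num.Theory.
Import numFieldNormedType.Exports.

Local Open Scope classical_set_scope.
Local Open Scope ring_scope.

(* A partition is the weakly decreasing list of its (positive) parts. *)
Definition is_partition (la : seq nat) : bool :=
  sorted geq la && (0%N \notin la).

(* Boxes (i, j) of the Young diagram: row i, column j, both counted from 0. *)
Definition in_diagram (la : seq nat) (i j : nat) : bool :=
  (i < size la)%N && (j < nth 0%N la i)%N.

Definition arm_length (la : seq nat) (i j : nat) : nat :=
  (nth 0 la i - j.+1)%N.

(* A lower row r has a box in column j exactly when its length exceeds j. *)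
Definition leg_length (la : seq nat) (i j : nat) : nat :=
  count (fun r => (j < r)%N) (drop i.+1 la).

Definition hook_length (la : seq nat) (i j : nat) : nat :=
  (arm_length la i j + leg_length la i j).+1.

Definition is_core (t : nat) (la : seq nat) : Prop :=
  forall i j : nat, in_diagram la i j -> ~~ (t %| hook_length la i j)%N.

Definition distinct_cores (s t : nat) : set (seq nat) :=
  [set la | [/\ is_partition la, uniq la, is_core s la & is_core t la]].

(* The expectation of X_{s,t}^k for the uniform distribution.  [fset_set A] is
   the finite set of the elements of [A] when [A] is finite, as is the case of
   [distinct_cores s t] for coprime s, t > 0, and empty otherwise. *)
Definition moment (R : realType) (s t k : nat) : R :=
  (\sum_(la <- fset_set (distinct_cores s t)) (sumn la)%:R ^+ k) /
  (#|` fset_set (distinct_cores s t)|)%:R.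

(* Main.v *)
(* A partition is encoded by its beta-set, the set of its first-column hook
   lengths.  It is a t-core iff its beta-set is closed under subtracting t as
   long as the result is nonnegative, and its parts are distinct iff the
   beta-set has no two consecutive elements.  For t = dn+1 or dn-1, an element
   x >= t of the beta-set of an (n,t)-core would give two consecutive elements
   (x-dn and x-t) or the element 0; so all elements are < t, and an (n,t)-core
   with distinct parts is the same thing as a family of numbers
   c_1, ..., c_(n-1) <= d (with c_(n-1) <= d-1 when t = dn-1), no two adjacent
   ones nonzero, where c_r counts the elements congruent to r mod n.  The size
   is a quadratic polynomial in the c_r.  Summing over the possible supports of
   c, the k-th power sum of the sizes and the number of cores are polynomials
   in d, of degrees at most 2k+a and exactly a, where a is the largest
   cardinality of a support; their quotient has the required expansion. *)

Require Import Defs.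
From mathcomp Require Import all_boot all_order all_algebra.
From mathcomp Require Import finmap.
From mathcomp Require Import all_classical all_reals all_analysis.
From mathcomp Require Import zify ring lra.

Set Implicit Arguments.
Unset Strict Implicit.
Unset Printing Implicit Defensive.

(** * Beta-sets *)

(* The hook lengths of the first column, listed from the top row down. *)
Fixpoint beta (s : seq nat) : seq nat :=
  if s is a :: s' then a + size s' :: beta s' else [::].

(** Inverse of [beta] on strictly decreasing lists: there each entry is at least the number of
    entries after it, so the truncated subtraction is exact. *)
Fixpoint unbeta (L : seq nat) : seq nat :=
  if L is x :: L' then x - size L' :: unbeta L' else [::].

Lemma size_beta s : size (beta s) = size s.
Proof. by elim: s => //= a s ->. Qed.

Lemma size_unbeta L : size (unbeta L) = size L.
Proof. by elim: L => //= a s ->. Qed.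

Lemma betaK : cancel beta unbeta.
Proof. by elim=> //= a s ->; rewrite size_beta addnK. Qed.

Lemma sorted_geq_cons a s :
  sorted geq (a :: s) = all (fun b => b <= a) s && sorted geq s.
Proof. by rewrite /= path_sortedE //; move=> y x z /= h1 h2; exact: leq_trans h2 h1. Qed.

Lemma sorted_gtn_cons a s :
  sorted gtn (a :: s) = all (fun b => b < a) s && sorted gtn s.
Proof. by rewrite /= path_sortedE //; move=> y x z /= h1 h2; exact: ltn_trans h2 h1. Qed.

Lemma size_le_all_lt x L : uniq L -> all (fun y => y < x) L -> size L <= x.
Proof.
move=> uL /allP hL; rewrite -(size_iota 0 x).
by apply: uniq_leq_size => // y /hL; rewrite mem_iota.
Qed.

Lemma sorted_gtn_uniq L : sorted gtn L -> uniq L.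
Proof.
apply: sorted_uniq => [y x z /= h1 h2|x /=]; last by rewrite ltnn.
exact: ltn_trans h2 h1.
Qed.

Lemma unbetaK L : sorted gtn L -> beta (unbeta L) = L.
Proof.
elim: L => //= x L IH; rewrite -/(sorted gtn (x :: L)) sorted_gtn_cons.
case/andP=> hx sL; rewrite IH // size_unbeta subnK //.
by rewrite size_le_all_lt // sorted_gtn_uniq.
Qed.

Lemma beta_bound a s x : all (fun b => b <= a) s -> x \in beta s -> x < a + size s.
Proof.
elim: s x => //= b s IH x /andP[hb hs]; rewrite inE => /predU1P[->|]; first by lia.
by move/(IH _ hs); lia.
Qed.

Lemma sorted_beta s : sorted geq s -> sorted gtn (beta s).
Proof.
elim: s => // a s IH; rewrite sorted_geq_cons => /andP[ha ss].
rewrite [beta _]/= sorted_gtn_cons IH // andbT.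
by apply/allP => x; exact: beta_bound.
Qed.

Lemma sorted_unbeta L : sorted gtn L -> sorted geq (unbeta L).
Proof.
elim: L => [//|x [//|y L] IH] h.
have /= := IH (path_sorted h); rewrite /= => ->; rewrite andbT.
by move: h => /= /andP[hxy _]; lia.
Qed.

Lemma unbeta_gt0 L : sorted gtn L -> 0 \notin L -> 0 \notin unbeta L.
Proof.
elim: L => //= x L IH; rewrite -/(sorted gtn (x :: L)) sorted_gtn_cons.
case/andP=> hx sL; rewrite !inE !negb_or => /andP[x0 L0].
rewrite IH // andbT.
suff : size L < x by lia.
(* Adjoining 0 to the tail gives one more distinct number below [x], which makes the bound
   strict. *)
apply: (@size_le_all_lt _ (0 :: L)); first by rewrite /= L0 sorted_gtn_uniq.
by rewrite /= hx andbT; lia.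
Qed.

Lemma beta_gt0 s : 0 \notin s -> 0 \notin beta s.
Proof.
by elim: s => //= a s IH; rewrite !inE !negb_or => /andP[h1 /IH ->]; rewrite andbT; lia.
Qed.

Lemma beta_gap s x : sorted geq s -> uniq s -> x \in beta s -> x.+1 \notin beta s.
Proof.
elim: s x => // a s IH x; rewrite sorted_geq_cons => /andP[ha ss] /= /andP[nas us].
(* As [a] does not recur, later parts are at most [a.-1], so later elements stay at least 2 below
   the head [a + size s]. *)
have ha' : all (fun b => b <= a.-1) s.
  apply/allP => b bs; have := allP ha _ bs.
  have : b != a by apply: contraNneq nas => <-.
  by lia.
rewrite !inE => /predU1P[->|xs]; rewrite negb_or.
  apply/andP; split; first by lia.
  by apply/negP => /(beta_bound ha); lia.
rewrite IH // andbT; have := beta_bound ha' xs.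
(* For [a = 0] the predecessor would be [a] itself; but the tail is nonempty and its first part is
   smaller than [a]. *)
suff : 0 < a by lia.
case: (s) xs nas ha => //= b s' _; rewrite inE negb_or => /andP[ab _] /andP[ba _].
by lia.
Qed.

(** Neighbouring entries differ by at least 2, while the numbers subtracted from them differ by 1,
    so the parts strictly decrease. *)
Lemma unbeta_uniq L : sorted gtn L -> (forall x, x \in L -> x.+1 \notin L) ->
  uniq (unbeta L).
Proof.
move=> sL hL; apply: sorted_gtn_uniq.
elim: L sL hL => [//|x [//|y L] IH] h hL.
have /= -> : sorted gtn (unbeta (y :: L)).
  apply: IH; first exact: path_sorted h.
  move=> z zL; have := hL z; rewrite inE zL orbT => /(_ isT).
  by rewrite inE negb_or => /andP[].
rewrite andbT /=; have := hL y; rewrite !inE eqxx orbT => /(_ isT).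
rewrite !negb_or => /andP[h1 _].
move: h; rewrite sorted_gtn_cons => /andP[/= /andP[h2 _] h3].
have : size L <= y.
  move: h3; rewrite -/(sorted gtn (y :: L)) sorted_gtn_cons => /andP[h3 h4].
  by rewrite size_le_all_lt // sorted_gtn_uniq.
by lia.
Qed.

(* Only [j < a] are columns of [a :: s]: the corresponding [y] are the gaps of
   [beta s] below [a + size s], which the hooks of the first row measure. *)
Lemma notin_betaP s y : sorted geq s ->
  reflect (exists j, y = j + count (fun r => r <= j) s) (y \notin beta s).
Proof.
elim: s y => [|b s IH] y; first by move=> _; apply: (iffP idP) => // _; exists y; rewrite addn0.
rewrite sorted_geq_cons => /andP[hb ss].
have cnt j : b <= j -> count (fun r => r <= j) s = size s.
  move=> bj; apply/eqP; rewrite -all_count; apply/allP => r /(allP hb).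
  by move=> h; apply: leq_trans bj.
rewrite /= inE negb_or; apply: (iffP andP).
  case=> ny /(IH _ ss)[j yE]; case: (ltngtP y (b + size s)) ny => // hy _.
    exists j; have [bj|] := leqP b j; first by move: yE; rewrite cnt //; lia.
    by rewrite add0n.
  exists (y - (size s).+1); have h : b <= y - (size s).+1 by lia.
  by rewrite h cnt //; lia.
case=> j; have [bj|jb] := leqP b j.
  rewrite cnt // => ->; split; first by lia.
  by apply/negP => /(beta_bound hb); lia.
rewrite add0n => yE; have := count_size (fun r => r <= j) s => hc.
by split; [lia|apply/(IH _ ss); exists j].
Qed.

(** * Hook lengths and the core condition *)

(** The hook is the head of the beta-set minus its [j]-th gap, the form that matches
    [notin_betaP]. *)
Lemma hook_length_cons0 a s j : j < a ->
  hook_length (a :: s) 0 j = a + size s - (j + count (fun r => r <= j) s).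
Proof.
rewrite /hook_length /arm_length /leg_length /= drop0 => ja.
rewrite -(count_predC (fun r => j < r) s).
rewrite (@eq_count _ (predC _) (fun r => r <= j)); first by lia.
by move=> r /=; rewrite -leqNgt.
Qed.

Lemma is_core_cons t a s : is_core t (a :: s) <->
  (forall j, j < a -> ~~ (t %| hook_length (a :: s) 0 j)) /\ is_core t s.
Proof.
split=> [h|[h1 h2]].
  by split=> [j ja|i j hij]; [apply: h|exact: (h i.+1 j)].
by case=> [|i] j; [exact: h1|exact: (h2 i j)].
Qed.

(** First-row hooks are the differences between the head of the beta-set and the gaps below it, and
    deleting the first row deletes the head; hence induction on the rows. Closure is stated for all
    multiples of [t] at once. *)
Lemma is_core_beta t s : sorted geq s ->
  is_core t s <->
  (forall x y, x \in beta s -> y < x -> t %| x - y -> y \in beta s).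
Proof.
elim: s => [_|a s IH]; first by split.
rewrite sorted_geq_cons => /andP[ha ss]; rewrite is_core_cons IH // {IH}.
split=> [[h1 h2] x y|h].
  rewrite /= !inE => /predU1P[->|xs] yx tx; last by rewrite (h2 x) ?orbT.
  rewrite (_ : y == _ = false) /=; last by lia.
  apply: contraTT tx => /(notin_betaP y ss)[j yE].
  (* A gap of index at least [a] lies at or above the head, contrary to [y < x]. *)
  have [aj|ja] := leqP a j.
    suff : count (fun r => r <= j) s = size s by lia.
    apply/eqP; rewrite -all_count; apply/allP => r /(allP ha).
    by move=> h; apply: leq_trans aj.
  by have := h1 _ ja; rewrite hook_length_cons0 // -yE.
split=> [j ja|x y xs yx tx].
  rewrite hook_length_cons0 //; apply/negP => tx.
  have /negP := introT (notin_betaP (j + count (fun r => r <= j) s) ss) (ex_intro _ j erefl).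
  apply; have hc := count_size (fun r => r <= j) s.
  have /= := h (a + size s) (j + count (fun r => r <= j) s).
  rewrite !inE eqxx => /(_ isT _ tx); case/(_ _)/predU1P => //; by lia.
have := h x y; rewrite /= !inE xs orbT => /(_ isT yx tx) /predU1P[] //.
by have := beta_bound ha xs; lia.
Qed.

(** The subtracted numbers are 0, 1, ..., [size L - 1]; their sum is moved to the left to avoid
    truncated subtraction. *)
Lemma sumn_unbeta L : sorted gtn L -> sumn (unbeta L) + 'C(size L, 2) = sumn L.
Proof.
elim: L => //= x L IH; rewrite -/(sorted gtn (x :: L)) sorted_gtn_cons.
case/andP=> hx sL; rewrite binS bin1 -IH //.
by have : size L <= x by [rewrite size_le_all_lt // sorted_gtn_uniq]; lia.
Qed.

(** * Abaci *)

(* The set with [c r] elements congruent to [r] mod [n], the smallest possible ones. *)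
Definition abacus (n : nat) (c : nat -> nat) : seq nat :=
  [seq r + j * n | r <- iota 0 n, j <- iota 0 (c r)].

Definition core_of (n : nat) (c : nat -> nat) : seq nat :=
  unbeta (sort geq (abacus n c)).

(* For [t = d n + 1] one takes [b = 0]; for [t = d n - 1], [b r = 1] if
   [r = n - 1] and [b r = 0] otherwise. *)
Definition admissible (n d : nat) (b c : nat -> nat) : Prop :=
  [/\ c 0 = 0, forall r, r.+1 < n -> c r = 0 \/ c r.+1 = 0
    & forall r, r < n -> c r <= d - b r].

Lemma mem_abacus n c x : 0 < n -> (x \in abacus n c) = (x %/ n < c (x %% n)).
Proof.
move=> n0; apply/allpairsPdep/idP => [[r [j []]]|h].
  rewrite !mem_iota => /= rn jc ->.
  by rewrite addnC divnMDl // modnMDl !modn_small // divn_small // addn0.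
exists (x %% n), (x %/ n); rewrite !mem_iota /= !add0n ltn_pmod // h.
by split=> //; rewrite addnC -divn_eq.
Qed.

Lemma abacus_uniq n c : uniq (abacus n c).
Proof.
apply: allpairs_uniq_dep => [|r _|]; rewrite ?iota_uniq //.
move=> _ _ /allpairsPdep[r [j [+ _ ->]]] /allpairsPdep[s [k [+ _ ->]]] /=.
rewrite !mem_iota => /= rn sn e.
have n0 : 0 < n by lia.
have := congr1 (modn^~ n) e; rewrite ![_ + _ * n]addnC !modnMDl !modn_small // => rs.
rewrite rs in e *; have /eqP : j * n = k * n by lia.
by rewrite eqn_pmul2r // => /eqP ->.
Qed.

Lemma sorted_abacus n c : sorted gtn (sort geq (abacus n c)).
Proof.
rewrite gtn_sorted_uniq_geq sort_uniq abacus_uniq /=; apply: sort_sorted.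
by move=> x y; exact: leq_total.
Qed.

Lemma beta_core_of n c : beta (core_of n c) = sort geq (abacus n c).
Proof. by rewrite unbetaK // sorted_abacus. Qed.

Lemma mem_beta_core_of n c x : 0 < n ->
  (x \in beta (core_of n c)) = (x %/ n < c (x %% n)).
Proof. by move=> n0; rewrite beta_core_of mem_sort mem_abacus. Qed.

Lemma core_of_inj n c c' : 0 < n -> core_of n c = core_of n c' ->
  forall r, r < n -> c r = c' r.
Proof.
move=> n0 e r rn.
have h j : (j < c r) = (j < c' r).
  have := congr1 (fun s => r + j * n \in beta s) e.
  by rewrite !mem_beta_core_of // addnC divnMDl // modnMDl modn_small // divn_small // addn0.
have := h (c r); have := h (c' r); lia.
Qed.

(** * Cores with distinct parts as admissible abaci *)

(** The hypothesis on [t] says that a nonzero residue [r] has exactly [d - b r] levels below [t].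
    Closure under [n] is built into the abacus, and closure under [t] is vacuous because all
    elements are below [t]. *)
Lemma core_of_distinct n t d b c : 1 < n ->
  (forall r j, 0 < r < n -> (r + j * n < t) = (j < d - b r)) ->
  admissible n d b c -> distinct_cores n t (core_of n c).
Proof.
move=> n1 tE [c0 cadj cd]; have n0 : 0 < n by lia.
have sL := sorted_abacus n c; have sG := sorted_unbeta sL.
have L0 : 0 \notin sort geq (abacus n c).
  by rewrite mem_sort mem_abacus // mod0n div0n c0.
have gap x : x \in sort geq (abacus n c) -> x.+1 \notin sort geq (abacus n c).
  rewrite !mem_sort !mem_abacus // => hx.
  have xn := ltn_pmod x n0; have xE := divn_eq x n.
  (* The successor of an element of residue [n - 1] has residue 0, and that runner is empty. *)
  have [h|h] := leqP n (x %% n).+1.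
    have -> : x.+1 %% n = 0.
      by rewrite xE -addnS (_ : (x %% n).+1 = n) ?modnDr ?modnMl //; lia.
    by rewrite c0.
  have -> : x.+1 %% n = (x %% n).+1 by rewrite {1}xE -addnS modnMDl modn_small.
  by have [cz|->] := cadj _ h; first by rewrite cz in hx.
have lt_t x : x \in beta (core_of n c) -> x < t.
  rewrite mem_beta_core_of // => hx; have xn := ltn_pmod x n0.
  rewrite (divn_eq x n) addnC tE; first exact: leq_trans (cd _ xn).
  by rewrite xn andbT lt0n; apply: contraTneq hx => ->; rewrite c0.
split.
- by rewrite /is_partition sG unbeta_gt0.
- exact: unbeta_uniq.
- apply/is_core_beta => // x y + yx /dvdnP[q qE].
  rewrite !mem_beta_core_of // (_ : x = q * n + y); last by lia.
  by rewrite divnMDl // modnMDl; lia.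
- apply/is_core_beta => // x y /lt_t xt yx /dvdn_leq; lia.
Qed.

Lemma distinct_core_gap n t la x : distinct_cores n t la ->
  x \in beta la -> x.+1 \notin beta la.
Proof. by case=> /andP[s0 _] u _ _; exact: beta_gap. Qed.

Lemma distinct_core_lt n d t la x : 0 < d -> 1 < n ->
  t = d * n + 1 \/ t = d * n - 1 ->
  distinct_cores n t la -> x \in beta la -> x < t.
Proof.
move=> d0 n1 tE h; have gap := @distinct_core_gap _ _ _ ^~ h.
case: h => /andP[sla la0] _ /(is_core_beta _ sla) hn /(is_core_beta _ sla) ht xb.
rewrite ltnNge; apply/negP => tx.
have dn : 0 < d * n - 1 by case: (d) d0 => // d' _; rewrite mulSn; lia.
have tb : x - t \in beta la.
  by apply: (ht x) => //; [case: tE; lia|rewrite subKn].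
case: tE => tE.
  (* This successor is [x - d * n]. *)
  have : (x - t).+1 \in beta la.
    apply: (hn x) => //; first by lia.
    by rewrite (_ : x - _ = d * n) ?dvdn_mull //; lia.
  by apply/negP; exact: gap.
(* Now [x - d * n] is the predecessor of [x - t], which exists only for [x > t]; the case [x = t]
   puts 0 in the beta-set. *)
have [xt|xt] := eqVneq x t.
  by move: tb; rewrite xt subnn; apply/negP; exact: beta_gt0.
have : (x - t).-1 \in beta la.
  apply: (hn x) => //; first by lia.
  by rewrite (_ : x - _ = d * n) ?dvdn_mull //; lia.
by move/gap; rewrite prednK ?tb //; lia.
Qed.

(** Closure under [n] makes each residue class of the beta-set an initial segment of its runner, so
    the runner heights determine it. *)
Lemma distinct_core_is_core_of n t d b la : 1 < n ->
  (forall r j, 0 < r < n -> (r + j * n < t) = (j < d - b r)) ->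
  distinct_cores n t la -> (forall x, x \in beta la -> x < t) ->
  exists2 c, admissible n d b c & core_of n c = la.
Proof.
move=> n1 tE h hlt; have gap := @distinct_core_gap _ _ _ ^~ h; have n0 : 0 < n by lia.
case: h => /andP[sla la0] _ /(is_core_beta _ sla) hn _.
have b0 := beta_gt0 la0.
(* The first missing level on runner [r]; [find] returns [d] when no level below [d] is missing. *)
pose c r := find (fun j => r + j * n \notin beta la) (iota 0 d).
have cP r j : r < n -> (j < c r) = (r + j * n \in beta la).
  move=> rn; apply/idP/idP => [jc|jb].
    have jd : j < d by apply: leq_trans jc _; rewrite -[X in _ <= X](size_iota 0) find_size.
    by have := before_find 0 jc; rewrite nth_iota // add0n => /negbT/negPn.
  rewrite ltnNge; apply/negP => cj.
  (* An element on runner 0 would bring 0 into the beta-set by closure; [tE] covers only the other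
     runners. *)
  have r0 : 0 < r.
    rewrite lt0n; apply: contra b0 => /eqP r0; move: jb; rewrite r0 add0n => jb.
    have [j0|j0] := posnP j; first by rewrite j0 in jb.
    by apply: (hn (j * n)); rewrite ?muln_gt0 ?j0 // subn0 dvdn_mull.
  have jd : j < d by move: (hlt _ jb); rewrite tE ?r0 //; lia.
  have hc : c r < size (iota 0 d) by rewrite size_iota; lia.
  have : has (fun j => r + j * n \notin beta la) (iota 0 d) by rewrite has_find.
  move/(nth_find 0); rewrite -/(c r) nth_iota ?add0n; last by lia.
  case/negP; have [->//|cj'] := eqVneq (c r) j.
  apply: (hn _ _ jb); first by rewrite ltn_add2l ltn_pmul2r //; lia.
  by rewrite subnDl -mulnBl dvdn_mull.
exists c; first split.
- apply/eqP; rewrite -leqn0 leqNgt cP // mul0n addn0; exact: b0.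
- move=> r rn; have [|c0] := posnP (c r); first by left.
  right; apply/eqP; rewrite -leqn0 leqNgt cP // mul0n addn0; apply: gap.
  by move: c0; rewrite cP ?mul0n ?addn0 //; lia.
- move=> r rn; have [->//|c0] := posnP (c r).
  have hc : (c r).-1 < c r by lia.
  have r0 : 0 < r.
    rewrite lt0n; apply: contraNneq b0 => r0.
    by move: c0; rewrite cP // mul0n addn0 r0.
  by move: hc; rewrite cP // => /hlt; rewrite tE ?r0 //; lia.
- apply: (can_inj betaK); rewrite beta_core_of.
  (* Strictly decreasing lists with the same elements are equal. *)
  apply: (@irr_sorted_eq _ gtn).
  + by move=> y x z /= h1 h2; exact: ltn_trans h2 h1.
  + by move=> y /=; rewrite ltnn.
  + exact: sorted_abacus.
  + exact: sorted_beta.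
  move=> x; rewrite mem_sort mem_abacus // cP ?ltn_pmod //.
  by rewrite addnC -divn_eq.
Qed.

(** * The size of a core from its runner heights *)

Lemma sum_iota_ap (r n m : nat) :
  \sum_(j <- iota 0 m) (r + j * n) = r * m + n * 'C(m, 2).
Proof.
elim: m => [|m IH]; first by rewrite /= big_nil muln0 bin0n muln0.
by rewrite -addn1 iotaD big_cat IH big_seq1 add0n addn1 binS bin1 mulnS mulnDr [m * n]mulnC /=; lia.
Qed.

Lemma sum_iota_ord n (F : nat -> nat) : \sum_(r <- iota 0 n) F r = \sum_(r < n) F r.
Proof. by rewrite -(big_mkord xpredT) /index_iota subn0. Qed.

Lemma sumn_core_of n c :
  sumn (core_of n c) + 'C(\sum_(r < n) c r, 2) =
  \sum_(r < n) (r * c r + n * 'C(c r, 2)).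
Proof.
have := sumn_unbeta (sorted_abacus n c).
rewrite size_sort (_ : size _ = \sum_(r < n) c r).
  rewrite /core_of => ->; rewrite sumnE (perm_big (abacus n c)); last by rewrite perm_sort.
  rewrite big_allpairs_dep sum_iota_ord.
  by apply: eq_bigr => r _; exact: sum_iota_ap.
rewrite size_allpairs_dep sumnE big_map sum_iota_ord.
by apply: eq_bigr => r _; rewrite size_iota.
Qed.

Import Order.TTheory GRing.Theory Num.Theory.
Import numFieldNormedType.Exports.

Local Open Scope classical_set_scope.
Local Open Scope ring_scope.

(** * Polynomial sums *)

(** The threshold [m] is there so that truncated differences [d - b] with [b <= m] agree with
    polynomials. *)
Definition poly_fun (R : realFieldType) (m e : nat) (f : nat -> R) : Prop :=
  exists2 p : {poly R}, (size p <= e.+1)%N &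
    forall d, (m <= d)%N -> f d = p.[d%:R].

Lemma poly_funW (R : realFieldType) m e e' (f : nat -> R) :
  (e <= e')%N -> poly_fun m e f -> poly_fun m e' f.
Proof. by move=> ee [p sp pE]; exists p => //; apply: leq_trans sp _. Qed.

Lemma poly_fun_ext (R : realFieldType) m e (f g : nat -> R) :
  (forall d, (m <= d)%N -> g d = f d) -> poly_fun m e f -> poly_fun m e g.
Proof. by move=> gf [p sp pE]; exists p => // d md; rewrite gf ?pE. Qed.

Lemma poly_fun_cst (R : realFieldType) m e (x : R) : poly_fun m e (fun=> x).
Proof.
exists x%:P => [|d _]; last by rewrite hornerC.
by apply: leq_trans (size_polyC_leq1 _) _.
Qed.

Lemma poly_fun_exp (R : realFieldType) m e : poly_fun m e (fun d => d%:R ^+ e : R).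
Proof. by exists 'X^e => [|d _]; rewrite ?size_polyXn // hornerXn. Qed.

Lemma poly_funD (R : realFieldType) m e (f g : nat -> R) :
  poly_fun m e f -> poly_fun m e g -> poly_fun m e (fun d => f d + g d).
Proof.
move=> [p sp pE] [q sq qE]; exists (p + q) => [|d md]; last by rewrite pE // qE // hornerD.
by apply: leq_trans (size_polyD _ _) _; rewrite geq_max sp.
Qed.

Lemma poly_funM (R : realFieldType) m e e' (f g : nat -> R) :
  poly_fun m e f -> poly_fun m e' g -> poly_fun m (e + e') (fun d => f d * g d).
Proof.
move=> [p sp pE] [q sq qE]; exists (p * q) => [|d md]; last by rewrite pE // qE // hornerM.
by apply: leq_trans (size_polyMleq _ _) _; lia.
Qed.

Lemma poly_funZ (R : realFieldType) m e x (f : nat -> R) :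
  poly_fun m e f -> poly_fun m e (fun d => x * f d).
Proof. exact: (poly_funM (poly_fun_cst m 0 x)). Qed.

Lemma poly_fun_sum (R : realFieldType) m e (I : eqType) (s : seq I) (P : pred I)
    (F : I -> nat -> R) :
  (forall i, i \in s -> P i -> poly_fun m e (F i)) ->
  poly_fun m e (fun d => \sum_(i <- s | P i) F i d).
Proof.
elim: s => [|i s IH] h.
  by apply: poly_fun_ext (poly_fun_cst m e 0) => d _; rewrite big_nil.
have hs : poly_fun m e (fun d => \sum_(i <- s | P i) F i d).
  by apply: IH => j js; apply: h; rewrite inE js orbT.
case: (boolP (P i)) => Pi.
  apply: poly_fun_ext (poly_funD (h i (mem_head _ _) Pi) hs) => d _.
  by rewrite big_cons Pi.
by apply: poly_fun_ext hs => d _; rewrite big_cons (negbTE Pi).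
Qed.

Lemma poly_fun_prod (R : realFieldType) m (I : Type) (s : seq I) (e : I -> nat)
    (F : I -> nat -> R) :
  (forall i, poly_fun m (e i) (F i)) ->
  poly_fun m (\sum_(i <- s) e i) (fun d => \prod_(i <- s) F i d).
Proof.
move=> h; elim: s => [|i s IH].
  rewrite big_nil; apply: poly_fun_ext (poly_fun_cst m 0 1) => d _.
  by rewrite big_nil.
rewrite big_cons; apply: poly_fun_ext (poly_funM (h i) IH) => d _.
by rewrite big_cons.
Qed.

(** Telescoping of [(j+1)^(a+1) - j^(a+1)], each difference expanded by the binomial theorem. *)
Lemma sum_exp_binomial (R : realFieldType) a d :
  d%:R ^+ a.+1 = \sum_(l < a.+1) 'C(a.+1, l)%:R * \sum_(j < d) (j%:R ^+ l : R).
Proof.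
elim: d => [|d IH].
  by rewrite expr0n /= big1 // => l _; rewrite big_ord0 mulr0.
rewrite -addn1 natrD addrC exprDn big_ord_recr /= binn subnn mul1r mulr1n IH addrC.
rewrite -big_split /=; apply: eq_bigr => l _.
by rewrite addn1 big_ord_recr /= expr1n mul1r mulrDr !mulr_natl.
Qed.

(** Strong induction: [sum_exp_binomial] is solved for its last term, whose coefficient [a + 1] is
    invertible. *)
Lemma poly_fun_power_sum (R : realFieldType) a :
  poly_fun 0 a.+1 (fun d => \sum_(j < d) (j%:R ^+ a : R)).
Proof.
elim/ltn_ind: a => a IH.
have h : poly_fun 0 a.+1 (fun d => a.+1%:R^-1 * (d%:R ^+ a.+1 +
    (-1) * \sum_(l < a) 'C(a.+1, l)%:R * \sum_(j < d) (j%:R ^+ l : R)) : R).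
  apply/poly_funZ/poly_funD; first exact: poly_fun_exp.
  apply/poly_funZ/poly_fun_sum => l _ _; apply: poly_funZ.
  by apply: poly_funW (IH l (ltn_ord l)); have := ltn_ord l; lia.
apply: poly_fun_ext h => d _; rewrite sum_exp_binomial big_ord_recr /= mulN1r.
by rewrite [X in X - _]addrC addrK binSn mulKf // pnatr_eq0.
Qed.

Lemma poly_fun_shift (R : realFieldType) m e b (f : nat -> R) :
  (b <= m)%N -> poly_fun 0 e f -> poly_fun m e (fun d => f (d - b).+1).
Proof.
move=> bm [p sp pE]; exists (p \Po ('X + (1 - b%:R)%:P)).
  by rewrite size_comp_poly2 // size_XaddC.
move=> d md; rewrite pE // horner_comp hornerD hornerX hornerC.
by congr p.[_]; rewrite -addn1 natrD natrB; [ring|lia].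
Qed.

(* The index [j = 0] is singled out because [0 ^+ 0 = 1]. *)
Lemma sum_ord_interval (R : realFieldType) (d b a : nat) :
  \sum_(j < d.+1 | (0 < j <= d - b)%N) (j%:R ^+ a : R) =
  \sum_(j < (d - b).+1) j%:R ^+ a + (-1) * 0 ^+ a.
Proof.
rewrite big_mkcond big_ord_recl /= add0r [in RHS]big_ord_recl /= mulN1r addrC addrA addNr add0r.
rewrite (big_ord_widen_cond d xpredT (fun i => (bump 0 i)%:R ^+ a)) ?leq_subr //.
by rewrite [RHS]big_mkcond.
Qed.

(** * Polynomials in several variables and their sums over boxes *)

(** An explicit list of monomials, as coefficients with exponent vectors, so that a sum over a box
    factors into one-variable sums. *)
Definition mpoly_fun (R : realFieldType) (I : finType) (e : nat)
    (F : (I -> nat) -> R) : Prop :=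
  exists2 s : seq (R * {ffun I -> nat}),
    (forall p, p \in s -> (\sum_i p.2 i <= e)%N) &
    forall c, F c = \sum_(p <- s) p.1 * \prod_i (c i)%:R ^+ p.2 i.

Lemma mpoly_funW (R : realFieldType) (I : finType) e e' (F : (I -> nat) -> R) :
  (e <= e')%N -> mpoly_fun e F -> mpoly_fun e' F.
Proof. by move=> ee [s hs FE]; exists s => // p /hs h; apply: leq_trans h ee. Qed.

Lemma mpoly_fun_cst (R : realFieldType) (I : finType) x :
  mpoly_fun 0 (fun _ : I -> nat => x : R).
Proof.
exists [:: (x, [ffun=> 0%N])] => [p|c].
  by rewrite inE => /eqP -> /=; rewrite big1 // => i _; rewrite ffunE.
by rewrite big_seq1 big1 ?mulr1 // => i _; rewrite ffunE.
Qed.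

Lemma mpoly_fun_var (R : realFieldType) (I : finType) (i : I) :
  mpoly_fun 1 (fun c => (c i)%:R : R).
Proof.
exists [:: (1, [ffun j => (j == i) : nat])] => [p|c].
  rewrite inE => /eqP -> /=; rewrite (bigD1 i) //= ffunE eqxx big1 // => j ji.
  by rewrite ffunE (negbTE ji).
rewrite big_seq1 mul1r (bigD1 i) //= ffunE eqxx expr1 big1 ?mulr1 // => j ji.
by rewrite ffunE (negbTE ji).
Qed.

Lemma mpoly_funD (R : realFieldType) (I : finType) e (F G : (I -> nat) -> R) :
  mpoly_fun e F -> mpoly_fun e G -> mpoly_fun e (fun c => F c + G c).
Proof.
move=> [s hs FE] [u hu GE]; exists (s ++ u) => [p|c].
  by rewrite mem_cat => /orP[/hs|/hu].
by rewrite big_cat FE GE.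
Qed.

Lemma mpoly_funM (R : realFieldType) (I : finType) e e' (F G : (I -> nat) -> R) :
  mpoly_fun e F -> mpoly_fun e' G -> mpoly_fun (e + e') (fun c => F c * G c).
Proof.
move=> [s hs FE] [u hu GE].
pose mul (p q : R * {ffun I -> nat}) := (p.1 * q.1, [ffun i => (p.2 i + q.2 i)%N]).
exists [seq mul p q | p <- s, q <- u].
  move=> _ /allpairsP[[p q] [/hs hp /hu hq ->]] /=.
  under eq_bigr do rewrite ffunE.
  by rewrite big_split leq_add.
move=> c; rewrite big_allpairs_dep FE GE big_distrlr /=.
apply: eq_bigr => p _; apply: eq_bigr => q _.
rewrite mulrACA -big_split /=; congr (_ * _); apply: eq_bigr => i _.
by rewrite ffunE exprD.
Qed.

Lemma mpoly_funZ (R : realFieldType) (I : finType) e x (F : (I -> nat) -> R) :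
  mpoly_fun e F -> mpoly_fun e (fun c => x * F c).
Proof. exact: (mpoly_funM (mpoly_fun_cst I x)). Qed.

Lemma mpoly_fun_ext (R : realFieldType) (I : finType) e (F G : (I -> nat) -> R) :
  (forall c, G c = F c) -> mpoly_fun e F -> mpoly_fun e G.
Proof. by move=> GF [s hs FE]; exists s => // c; rewrite GF. Qed.

Lemma mpoly_fun_sum (R : realFieldType) (I : finType) (J : Type) e (s : seq J)
    (F : J -> (I -> nat) -> R) :
  (forall j, mpoly_fun e (F j)) -> mpoly_fun e (fun c => \sum_(j <- s) F j c).
Proof.
move=> h; elim: s => [|j s IH].
  apply: mpoly_fun_ext (mpoly_funW (leq0n e) (mpoly_fun_cst I 0)) => c.
  by rewrite big_nil.
by apply: mpoly_fun_ext (mpoly_funD (h j) IH) => c; rewrite big_cons.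
Qed.

Lemma mpoly_funX (R : realFieldType) (I : finType) e k (F : (I -> nat) -> R) :
  mpoly_fun e F -> mpoly_fun (e * k) (fun c => F c ^+ k).
Proof.
move=> h; elim: k => [|k IH]; first by rewrite muln0; exact: mpoly_fun_cst.
by rewrite mulnS; apply: mpoly_fun_ext (mpoly_funM h IH) => c; rewrite exprS.
Qed.

(** The product of these conditions selects the tuples with support exactly [A] and entries at most
    [d - b i] on it. *)
Definition box (I : finType) (b : I -> nat) (A : {set I}) (d : nat) (i : I) :
    pred 'I_d.+1 :=
  fun j => if i \in A then (0 < j <= d - b i)%N else (j == 0 :> nat).

Lemma sum_box_exp (R : realFieldType) (I : finType) m (b : I -> nat) (A : {set I}) i a :
  (b i <= m)%N ->
  poly_fun m (a + (i \in A)) (fun d => \sum_(j | box b A i j) ((j : 'I_d.+1)%:R ^+ a : R)).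
Proof.
rewrite /box; case: (i \in A) => bm.
  apply: (@poly_fun_ext _ _ _
    (fun d => \sum_(j < (d - b i).+1) j%:R ^+ a + (-1) * 0 ^+ a)).
    by move=> d _; exact: sum_ord_interval.
  apply: poly_funD; last exact: poly_fun_cst.
  apply: (poly_fun_shift (f := fun d => \sum_(j < d) j%:R ^+ a) bm).
  by rewrite addn1; exact: poly_fun_power_sum.
apply: poly_fun_ext (poly_fun_cst m _ (0 ^+ a)) => d _.
by rewrite (big_pred1 ord0).
Qed.

(** Each monomial sums to a product of one-variable power sums, and every index in [A] raises the
    degree by one. *)
Lemma sum_box (R : realFieldType) (I : finType) m (b : I -> nat) (A : {set I}) e
    (F : (I -> nat) -> R) :
  (forall i, (b i <= m)%N) -> mpoly_fun e F ->
  poly_fun m (e + #|A|)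
    (fun d => \sum_(c : {ffun I -> 'I_d.+1} | c \in family (box b A (d := d)))
                F (fun i => c i)).
Proof.
move=> bm [s hs FE].
apply: (@poly_fun_ext _ _ _ (fun d => \sum_(p <- s) p.1 *
    \prod_i \sum_(j | box b A i j) ((j : 'I_d.+1)%:R ^+ p.2 i : R))).
  move=> d _; under eq_bigr do rewrite FE.
  rewrite exchange_big /=; apply: eq_bigr => p _.
  by rewrite -mulr_sumr bigA_distr_big_dep.
apply: poly_fun_sum => p /hs hp _; apply: poly_funZ.
apply: (poly_funW _ (poly_fun_prod _ (fun i => sum_box_exp R A (p.2 i) (bm i)))).
rewrite big_split /= (_ : \sum_i (i \in A : nat) = #|A|)%N ?leq_add2r //.
by rewrite -sum1_card [RHS]big_mkcond; apply: eq_bigr => i _; case: (i \in A).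
Qed.

(** The exact number of tuples, from which the lower bound on the number of cores is obtained. *)
Lemma sum_box1 (R : realFieldType) (I : finType) (b : I -> nat) (A : {set I}) d :
  \sum_(c : {ffun I -> 'I_d.+1} | c \in family (box b A (d := d))) 1 =
  \prod_(i in A) (d - b i)%:R :> R.
Proof.
transitivity (\prod_i \sum_(j | box b A (d := d) i j) (1 : R)).
  by rewrite bigA_distr_big_dep; apply: eq_bigr => c _; rewrite big1.
rewrite [RHS]big_mkcond; apply: eq_bigr => i _; rewrite /box.
case: (i \in A); last by rewrite (big_pred1 ord0).
have := sum_ord_interval R d (b i) 0.
have e n (P : pred 'I_n) : \sum_(j < n | P j) (j%:R ^+ 0 : R) = \sum_(j < n | P j) 1.
  by apply: eq_bigr => j _; rewrite expr0.
by rewrite !e => ->; rewrite sumr_const card_ord expr0 -natr1; ring.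
Qed.

(** * The size as a quadratic polynomial *)

Lemma natr_bin2 (R : realFieldType) m : 'C(m, 2)%:R = 2^-1 * (m%:R * (m%:R + -1)) :> R.
Proof.
elim: m => [|m IH]; first by rewrite bin0n !mul0r mulr0.
by rewrite binS bin1 natrD IH -natr1; field.
Qed.

Definition core_size (R : realFieldType) (n : nat) (c : 'I_n -> nat) : R :=
  \sum_(r < n) (r%:R * (c r)%:R + n%:R * (2^-1 * ((c r)%:R * ((c r)%:R + -1)))) +
  (-1) * (2^-1 * ((\sum_(r < n) (c r)%:R) * (\sum_(r < n) (c r)%:R + -1))).

Lemma natr_sumn_core_of (R : realFieldType) n (c : nat -> nat) :
  (sumn (core_of n c))%:R = core_size R (fun r : 'I_n => c r).
Proof.
have /(congr1 (fun m => m%:R : R)) := sumn_core_of n c.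
rewrite natrD natr_bin2 natr_sum => /(canRL (addrK _)) ->.
rewrite /core_size natr_sum mulN1r; congr (_ - _); apply: eq_bigr => r _.
by rewrite natrD !natrM natr_bin2.
Qed.

Lemma mpoly_fun_core_size (R : realFieldType) n : mpoly_fun 2 (@core_size R n).
Proof.
have sq (F : ('I_n -> nat) -> R) : mpoly_fun 1 F ->
    mpoly_fun 2 (fun c => 2^-1 * (F c * (F c + -1))).
  move=> h; apply/mpoly_funZ/(mpoly_funM h)/mpoly_funD => //.
  by apply: mpoly_funW (mpoly_fun_cst _ (-1)).
apply: mpoly_funD; last first.
  by apply/mpoly_funZ/sq/mpoly_fun_sum => r; exact: mpoly_fun_var.
apply: mpoly_fun_sum => r; apply: mpoly_funD.
  by apply: mpoly_funZ; apply: mpoly_funW (mpoly_fun_var R r).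
by apply/mpoly_funZ/sq/mpoly_fun_var.
Qed.

(** * Summation over cores *)

(** The possible supports of admissible tuples. *)
Definition sparse_sets (n : nat) : {set {set 'I_n}} :=
  [set A : {set 'I_n} | [forall i in A, (0 < i)%N] &&
     [forall i in A, forall j in A, j != i.+1 :> nat]].

Definition support n d (c : {ffun 'I_n -> 'I_d.+1}) : {set 'I_n} :=
  [set i | (0 < c i)%N].

(** Extension by zero, linking the finite type of tuples, over which one sums, to [admissible]. *)
Definition extend n d (c : {ffun 'I_n -> 'I_d.+1}) (r : nat) : nat :=
  if insub r is Some i then c i else 0%N.

Definition admissibleb n d (b : nat -> nat) (c : {ffun 'I_n -> 'I_d.+1}) : bool :=
  (support c \in sparse_sets n) && [forall i : 'I_n, (c i <= d - b i)%N].

Lemma extend_ord n d (c : {ffun 'I_n -> 'I_d.+1}) (i : 'I_n) : extend c i = c i.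
Proof. by rewrite /extend valK. Qed.

Lemma admissibleP n d b (c : {ffun 'I_n -> 'I_d.+1}) : (0 < n)%N ->
  reflect (admissible n d b (extend c)) (admissibleb b c).
Proof.
move=> n0; apply: (iffP andP) => [[]|[c0 cadj cd]].
  rewrite inE => /andP[/forall_inP h0 /forall_inP hadj] /forallP hd.
  split.
  - rewrite -[0%N]/(val (Ordinal n0)) extend_ord; apply/eqP; rewrite -leqn0 leqNgt.
    by apply/negP => h; have := h0 (Ordinal n0); rewrite inE h => /(_ isT).
  - move=> r rn; rewrite -[r]/(val (Ordinal (ltnW rn))) -[r.+1]/(val (Ordinal rn)).
    rewrite !extend_ord.
    have [|hr] := posnP (c (Ordinal (ltnW rn))); first by left.
    have [|hr1] := posnP (c (Ordinal rn)); first by right.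
    have := hadj (Ordinal (ltnW rn)); rewrite inE hr => /(_ isT) /forall_inP.
    by move=> /(_ (Ordinal rn)); rewrite inE hr1 /= eqxx => /(_ isT).
  - by move=> r rn; rewrite -[r]/(val (Ordinal rn)) extend_ord.
split; last by apply/forallP => i; rewrite -extend_ord; apply: cd.
rewrite inE; apply/andP; split.
  apply/forall_inP => i; rewrite inE -extend_ord lt0n; apply: contraR.
  by rewrite -eqn0Ngt => /eqP ->; rewrite c0.
apply/forall_inP => i; rewrite inE => ci; apply/forall_inP => j; rewrite inE => cj.
apply/eqP => ji; have := cadj i; rewrite -ji ltn_ord !extend_ord => /(_ isT).
by case=> e; [move: ci|move: cj]; rewrite e.
Qed.

Lemma core_of_ext n (c c' : nat -> nat) :
  (forall r, (r < n)%N -> c r = c' r) -> core_of n c = core_of n c'.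
Proof.
move=> cc'; rewrite /core_of /abacus; congr (unbeta (sort _ (flatten _))).
by apply/eq_in_map => r; rewrite mem_iota /= => /cc' ->.
Qed.

(** [core_of] is a bijection from admissible tuples to cores. It also shows that the set of cores is
    finite, so [fset_set] does not take its default empty value. *)
Lemma sum_distinct_cores (V : nmodType) n t d b (f : seq nat -> V) :
  (1 < n)%N -> (0 < d)%N -> t = (d * n + 1)%N \/ t = (d * n - 1)%N ->
  (forall r j, (0 < r < n)%N -> (r + j * n < t)%N = (j < d - b r)%N) ->
  \sum_(la <- fset_set (distinct_cores n t)) f la =
  \sum_(c : {ffun 'I_n -> 'I_d.+1} | admissibleb b c) f (core_of n (extend c)).
Proof.
move=> n1 d0 tE tP; have n0 : (0 < n)%N by lia.
pose g (c : {ffun 'I_n -> 'I_d.+1}) := core_of n (extend c).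
pose s := [seq g c | c <- enum (fun c : {ffun 'I_n -> 'I_d.+1} => admissibleb b c)].
have dE : distinct_cores n t = [set` s].
  rewrite predeqE => la /=; split=> [h|].
    have [x xb|c hc <-] := distinct_core_is_core_of n1 tP h; first exact: (distinct_core_lt d0 n1 tE h xb).
    apply/mapP; exists [ffun i : 'I_n => inord (c i)].
      rewrite mem_enum; apply/admissibleP => //.
      case: hc => c0 cadj cd.
      have cE r : (r < n)%N -> extend [ffun i : 'I_n => inord (c i) : 'I_d.+1] r = c r.
        move=> rn; rewrite -[r]/(val (Ordinal rn)) extend_ord ffunE inordK //.
        by rewrite ltnS; apply: leq_trans (cd _ rn) (leq_subr _ _).
      split=> [|r rn|r rn]; rewrite !cE //; last exact: cd.
        by apply: cadj.
      by lia.
    apply: core_of_ext => r rn; rewrite -[r]/(val (Ordinal rn)) extend_ord ffunE inordK //.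
    by case: hc => _ _ cd; rewrite ltnS; apply: leq_trans (cd _ rn) (leq_subr _ _).
  move=> /mapP[c]; rewrite mem_enum => /(admissibleP _ _ n0) hc ->.
  exact: core_of_distinct tP hc.
have us : uniq s.
  rewrite map_inj_in_uniq ?enum_uniq // => c c' _ _ e.
  apply/ffunP => i; apply: val_inj; rewrite /= -!extend_ord.
  exact: (core_of_inj n0 e).
rewrite (perm_big s); first by rewrite big_map big_enum.
apply: uniq_perm; rewrite ?fset_uniq // => la.
rewrite dE in_fset_set; last exact: finite_seq.
by rewrite mem_setE.
Qed.

Lemma sum_admissible (V : nmodType) n d b (F : {ffun 'I_n -> 'I_d.+1} -> V) :
  \sum_(c | admissibleb b c) F c =
  \sum_(A in sparse_sets n) \sum_(c in family (box (fun i : 'I_n => b i) A (d := d))) F c.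
Proof.
rewrite (partition_big (@support n d) (fun A => A \in sparse_sets n)) /=; last first.
  by move=> c /andP[].
apply: eq_bigr => A AS; apply: eq_bigl => c; rewrite /admissibleb.
apply/idP/familyP => [/andP[/andP[_ /forallP hc] /eqP <-] i|h].
  by rewrite unfold_in /box inE lt0n; case: eqP => //= _; exact: hc.
have sA : support c = A.
  apply/setP => i; rewrite inE; have := h i; rewrite unfold_in /box.
  by case: (i \in A) => [/andP[]//|/eqP ->].
rewrite sA AS eqxx andbT; apply/forallP => i; have := h i; rewrite unfold_in /box.
by case: (i \in A) => [/andP[]//|/eqP ->].
Qed.

Lemma set0_sparse n : finset.set0 \in sparse_sets n.
Proof. by rewrite inE; apply/andP; split; apply/forall_inP => i; rewrite inE. Qed.

(** * Asymptotics *)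

Lemma horner_bound (R : realFieldType) (p : {poly R}) e : (size p <= e.+1)%N ->
  exists K : R, 0 <= K /\ forall d : nat, (0 < d)%N -> `|p.[d%:R]| <= K * d%:R ^+ e.
Proof.
move=> sp; exists (\sum_(i < size p) `|p`_i|); split; first by apply: sumr_ge0.
move=> d d0; rewrite horner_coef mulr_suml; apply: le_trans (ler_norm_sum _ _ _) _.
apply: ler_sum => i _; rewrite normrM ler_wpM2l // normrX normr_nat.
by rewrite ler_weXn2l ?ler1n //; have := ltn_ord i; lia.
Qed.

(* Only the coefficients of [p] in degree [e + a] and of [q] in degree [a] matter. *)
Lemma ratio_asymptotics (R : archiRealFieldType) (p q : {poly R}) e a :
  (0 < e)%N -> (size p <= (e + a).+1)%N -> (size q <= a.+1)%N ->
  (forall d : nat, (0 < d)%N -> (d%:R - 1) ^+ a <= q.[d%:R]) ->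
  exists C K : R, forall d : nat, (1 < d)%N ->
    `|p.[d%:R] / q.[d%:R] - C * d%:R ^+ e| <= K * d%:R ^+ e.-1.
Proof.
move=> e0 sp sq qlow.
(* For [d >= 2] one has [d - 1 >= d / 2]. *)
have qd (d : nat) : (1 < d)%N -> (d%:R / 2) ^+ a <= q.[d%:R].
  move=> d1; apply: le_trans (qlow d _); last by lia.
  by apply: lerXn2r; rewrite ?nnegrE; have : (2 <= d%:R :> R) by [rewrite ler_nat]; lra.
have q0 (d : nat) : (1 < d)%N -> 0 < q.[d%:R].
  move=> d1; apply: lt_le_trans (qd d d1); apply: exprn_gt0.
  by rewrite divr_gt0 // ltr0n; lia.
(* Otherwise [q] would have degree below [a] and could not stay above [(d/2)^a] for large [d]. *)
have qa : q`_a != 0.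
  apply/eqP => qa.
  have sq' : (size q <= a)%N.
    rewrite leqNgt; apply/negP => h; have sE : size q = a.+1 by lia.
    have : lead_coef q != 0 by rewrite lead_coef_eq0 -size_poly_eq0 sE.
    by rewrite lead_coefE sE qa eqxx.
  case: a {sp qlow sq qa} qd sq' => [|a] qd sq.
    have := q0 2 isT; rewrite (_ : q = 0) ?horner0 ?ltxx //.
    by apply/eqP; rewrite -size_poly_eq0; lia.
  have [K [K0 hK]] := horner_bound sq.
  have [N hN] : exists N : nat, K * 2 ^+ a.+1 < N%:R.
    exists (Num.bound (K * 2 ^+ a.+1)); apply: archi_boundP.
    by rewrite mulr_ge0 ?exprn_ge0.
  have d1 : (1 < N.+2)%N by [].
  have := le_trans (qd _ d1) (le_trans (ler_norm _) (hK N.+2 isT)).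
  rewrite expr_div_n ler_pdivrMr ?exprn_gt0 // exprS mulrAC ler_pM2r ?exprn_gt0 ?ltr0n //.
  by move=> h; have := le_lt_trans h hN; rewrite ltr_nat; lia.
(* This choice cancels the coefficient of degree [e + a] in [r]. *)
pose C := p`_(e + a) / q`_a.
pose r := p - C *: ('X^e * q).
have sr : (size r <= (e.-1 + a).+1)%N.
  apply/leq_sizeP => j; rewrite (_ : (_ + _).+1 = e + a)%N; last by lia.
  rewrite leq_eqVlt coefB coefZ coefXnM => /predU1P[<-|ej].
    by rewrite ltnNge leq_addr /= addKn /C divfK // subrr.
  rewrite ltnNge (_ : (e <= j)%N) /=; last by lia.
  have -> : p`_j = 0 by apply: nth_default; exact: leq_trans sp ej.
  have -> : q`_(j - e) = 0 by apply: nth_default; apply: leq_trans sq _; lia.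
  by rewrite mulr0 subr0.
have [K [K0 hK]] := horner_bound sr.
(* The factor [2 ^+ a] comes from dividing by the lower bound [(d/2)^a] of [q]. *)
exists C, (K * 2 ^+ a) => d d1; have d0 : (0 < d)%N by lia.
have -> : p.[d%:R] / q.[d%:R] - C * d%:R ^+ e = r.[d%:R] / q.[d%:R].
  rewrite hornerD hornerN hornerZ hornerM hornerXn mulrBl -!mulrA divff ?mulr1 //.
  by rewrite gt_eqF ?q0.
rewrite normrM normfV (gtr0_norm (q0 _ d1)) ler_pdivrMr ?q0 //.
apply: le_trans (hK d d0) _; rewrite exprD -!mulrA ler_wpM2l //.
rewrite mulrCA ler_wpM2l ?exprn_ge0 //.
apply: le_trans (ler_wpM2l _ (qd _ d1)); rewrite ?exprn_ge0 //.
by rewrite expr_div_n mulrC divfK // expf_neq0.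
Qed.

Lemma moment_asymptotics (R : realType) n k (t : nat -> nat) (b : nat -> nat) :
  (1 < n)%N -> (0 < k)%N -> (forall r, (b r <= 1)%N) ->
  (forall d, t d = (d * n + 1)%N) \/ (forall d, t d = (d * n - 1)%N) ->
  (forall d r j, (0 < d)%N -> (0 < r < n)%N ->
     (r + j * n < t d)%N = (j < d - b r)%N) ->
  exists C : R, (fun d : nat => moment R n (t d) k) =
    (fun d : nat => C * d%:R ^+ (2 * k))
    +O_\oo (fun d : nat => d%:R ^+ (2 * k - 1) : R).
Proof.
move=> n1 k0 b1 tE tP.
(* A largest support fixes the degree of the counting polynomial. *)
have [A0 A0S A0max] : exists2 A0, A0 \in sparse_sets n &
    forall A, A \in sparse_sets n -> (#|A| <= #|A0|)%N.
  have := set0_sparse n; case: (@arg_maxnP _ finset.set0 (fun A => A \in sparse_sets n) (fun A => #|A|)).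
    exact: set0_sparse.
  by move=> A0 AS h _; exists A0.
have sumP d (f : seq nat -> R) : (0 < d)%N ->
    \sum_(la <- fset_set (distinct_cores n (t d))) f la =
    \sum_(A in sparse_sets n)
      \sum_(c in family (box (fun i : 'I_n => b i) A (d := d))) f (core_of n (extend c)).
  move=> d0; rewrite (@sum_distinct_cores _ n (t d) d b) //.
  - exact: sum_admissible.
  - by case: tE => ->; [left|right].
  - by move=> r j; exact: tP.
have pf e (F : ('I_n -> nat) -> R) : mpoly_fun e F -> poly_fun 1 (e + #|A0|)
    (fun d => \sum_(A in sparse_sets n)
      \sum_(c : {ffun 'I_n -> 'I_d.+1} | c \in family (box (fun i : 'I_n => b i) A (d := d)))
        F (fun i => c i)).
  move=> hF; apply: poly_fun_sum => A _ AS.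
  by apply: (poly_funW _ (sum_box A _ hF)) => //; rewrite leq_add2l A0max.
have [p sp pE] := pf _ _ (mpoly_funX k (mpoly_fun_core_size R n)).
(* Summing the constant 1 counts the cores. *)
have [q sq qE] := pf _ _ (mpoly_fun_cst 'I_n 1).
have qlow (d : nat) : (0 < d)%N -> (d%:R - 1) ^+ #|A0| <= q.[d%:R].
  (* Only the tuples with support [A0] are kept; each factor [d - b i] is at least [d - 1]. *)
  move=> d0; rewrite -qE // (bigD1 A0) //= ler_wpDr //.
    by apply: sumr_ge0 => A _; apply: sumr_ge0.
  rewrite sum_box1 -prodr_const; apply: ler_prod => i _.
  rewrite subr_ge0 ler1n d0 lerBlDr natr1 ler_nat.
  by have := b1 i; lia.
have momE d : (0 < d)%N -> moment R n (t d) k = p.[d%:R] / q.[d%:R].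
  move=> d0; rewrite /moment -pE // -qE // sumP //; congr (_ / _).
    apply: eq_bigr => A _; apply: eq_bigr => c _.
    rewrite natr_sumn_core_of; congr (core_size _ _ ^+ _).
    by apply/funext => i; rewrite extend_ord.
  transitivity (\sum_(la <- fset_set (distinct_cores n (t d))) (1 : R)); last by rewrite sumP.
  by rewrite big_const_seq count_predT iter_addr_0.
have [|C [K hK]] := @ratio_asymptotics R p q (2 * k) _ _ sp sq qlow; first by lia.
exists C; apply/eqaddOP; exists K; split=> [|x Kx]; first exact: num_real.
near=> d; have d1 : (1 < d)%N by near: d; exact: nbhs_infty_gt.
change (`|moment R n (t d) k - C * d%:R ^+ (2 * k)| <= x * `|d%:R ^+ (2 * k - 1)|).
rewrite momE; last exact: ltnW.
apply: le_trans (hK d d1) _.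
by rewrite ger0_norm ?exprn_ge0 // subn1 ler_wpM2r ?exprn_ge0 // ltW.
Unshelve. all: by end_near.
Qed.

Theorem theorem1p8 (R : realType) (n k : nat) (hn : (2 <= n)%N) (hk : (1 <= k)%N) :
  exists C D : R,
    (fun d : nat => moment R n (d * n + 1) k) =
      (fun d : nat => C * d%:R ^+ (2 * k))
      +O_\oo (fun d : nat => d%:R ^+ (2 * k - 1) : R)
    /\
    (fun d : nat => moment R n (d * n - 1) k) =
      (fun d : nat => D * d%:R ^+ (2 * k))
      +O_\oo (fun d : nat => d%:R ^+ (2 * k - 1) : R).
Proof.
have [|||C hC] := @moment_asymptotics R n k (fun d => d * n + 1)%N (fun=> 0%N) hn hk.
- by [].
- by left.
- move=> d r j d0 /andP[r0 rn]; rewrite subn0; apply/idP/idP => h.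
    rewrite ltnNge; apply/negP => dj.
    by have := leq_mul dj (leqnn n); lia.
  by have := leq_mul h (leqnn n); rewrite mulSn; lia.
have [|||D hD] := @moment_asymptotics R n k (fun d => d * n - 1)%N
  (fun r => (r == n.-1 : nat)) hn hk.
- by move=> r; case: eqP.
- by right.
- move=> d r j d0 /andP[r0 rn].
  have dn := leq_mul d0 (leqnn n).
  (* On residue [n - 1], level [d - 1] holds [t] itself and so is lost; the other nonzero residues
     keep all [d] levels. *)
  case: eqP => [->|rn']; rewrite ?subn0; apply/idP/idP => h.
  + rewrite ltnNge; apply/negP => dj.
    have /leq_mul/(_ (leqnn n)) : (d <= j.+1)%N by lia.
    by rewrite mulSn; lia.
  + have /leq_mul/(_ (leqnn n)) : (j.+2 <= d)%N by lia.
    by rewrite !mulSn; lia.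
  + rewrite ltnNge; apply/negP => dj.
    by have := leq_mul dj (leqnn n); lia.
  + by have := leq_mul h (leqnn n); rewrite mulSn; lia.
by exists C, D.
Qed.
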